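(* Let $(Z,\mathcal F)$ be a foliated manifold and $C\to Z$ a complex line bundle. Any (linear) leafwise connection on $C\to Z$ comes from a (linear) connection on $C\to Z$; that is, for every leafwise connection $A_{\mathcal F}$ on $C\to Z$ there is a linear connection $\Gamma$ on $C\to Z$ whose induced leafwise connection $\Gamma_{\mathcal F}$ equals $A_{\mathcal F}$.
   Context: Manifolds are smooth, Hausdorff, second-countable and connected. A (regular) foliation $\mathcal F$ of $Z$ consists of the maximal integral manifolds of an involutive distribution $T\mathcal F\subset TZ$; adapted coordinates $(z^\lambda;z^i)$ are such that leaves are locally $z^\lambda=\mathrm{const}$. $T\mathcal F^*$ is the dual of $T\mathcal F$, with local basis $\{\tilde dz^i\}$ dual to $\{\partial_i\}$. The inverse images $\pi^{-1}(F)$ of leaves under $\pi:C\to Z$ form a foliation $C_{\mathcal F}$ of $C$. A (linear) leafwise connection on $C\to Z$ is a splitting, linear over $C$, of the exact sequence of vector bundles over $C$ $$0\to VC\to TC_{\mathcal F}\to C\times_ZT\mathcal F\to0,$$ where $VC$ is the (holomorphic) vertical tangent bundle and $TC_{\mathcal F}$ the (holomorphic, along fibres) tangent bundle of $C_{\mathcal F}$. In bundle coordinates $(z^\lambda;z^i;c)$ it is represented by $A_{\mathcal F}=\tilde dz^i\otimes(\partial_i+A_ic\,\partial_c)$ with local complex functions $A_i$ on $Z$; equivalently, by the covariant derivative $\nabla^{\mathcal F}s=\tilde ds-A_is\,\tilde dz^i$ on sections $s$, i.e. an assignment to each global section $\tau$ of $T\mathcal F$ (depending $C^\infty(Z)$-linearly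 on $\tau$) of an endomorphism $\nabla^{\mathcal F}_\tau$ of the space of sections of $C$ with $\nabla^{\mathcal F}_\tau(fs)=(\tau\rfloor\tilde df)s+f\nabla^{\mathcal F}_\tau s$ for $f\in C^\infty(Z)$, where $\tilde d f$ is the restriction of $df$ to $T\mathcal F$. A linear connection $\Gamma=dz^\lambda\otimes(\partial_\lambda+\Gamma_\lambda c\,\partial_c)+dz^i\otimes(\partial_i+\Gamma_ic\,\partial_c)$ on $C\to Z$ induces the leafwise connection $\Gamma_{\mathcal F}=\tilde dz^i\otimes(\partial_i+\Gamma_ic\,\partial_c)$ (restriction of the covariant derivative to vector fields tangent to $\mathcal F$); a leafwise connection ''comes from'' $\Gamma$ if it equals $\Gamma_{\mathcal F}$. *)

(* Defs.v *)
From HB Require Import structures.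
From mathcomp Require Import all_boot all_order all_algebra.
From mathcomp Require Import complex.
From mathcomp Require Import all_classical all_reals topology normedtype derive.

Set Implicit Arguments.
Unset Strict Implicit.
Unset Printing Implicit Defensive.

Import Order.TTheory GRing.Theory Num.Theory.
Import numFieldNormedType.Exports.

Local Open Scope classical_set_scope.
Local Open Scope ring_scope.

Section EuclideanSmooth.
Context {R : realType} {n : nat}.
Implicit Types (f g : 'rV[R]_n -> R^o) (U : set 'rV[R]_n).

(* [U] is meant to be open. All iterated partial derivatives up to order [k] are
   required to exist and to be continuous on [U]. *)
Fixpoint Ck_on (k : nat) U f : Prop :=
  (forall x, U x -> {for x, continuous f}) /\
  if k is k'.+1 then
    forall i : 'I_n, (forall x, U x -> derivable f x (delta_mx 0 i)) /\
                     Ck_on k' U (fun x => 'D_(delta_mx 0 i) f x)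
  else True.

Definition Cinfty_on U f : Prop := forall k, Ck_on k U f.

Lemma Ck_on_eq k U f g : open U -> (forall x, U x -> f x = g x) ->
  Ck_on k U f -> Ck_on k U g.
Proof.
move=> oU; elim: k f g => [|k IH] f g fg [cf df].
all: have near_fg x : U x -> \forall y \near x, f y = g y by
  move=> Ux; apply: filterS fg _; apply: open_nbhs_nbhs.
all: have cg x : U x -> {for x, continuous g} by
  move=> Ux; rewrite /prop_for /continuous_at -(fg x Ux);
  apply: cvg_trans (cf x Ux); exact: (near_eq_cvg (near_fg x Ux)).
all: split=> //.
move=> i; have [d1 d2] := df i; split.
  by move=> x Ux; apply: near_eq_derivable (d1 x Ux); exact: near_fg.
by apply: IH d2 => x Ux; apply: near_eq_derive; exact: near_fg.
Qed.

Lemma Ck_onW k U f : Ck_on k.+1 U f -> Ck_on k U f.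
Proof.
elim: k f => [|k IH] f [cf df]; first by split.
split; first exact: cf.
by move=> i; have [d1 d2] := df i; split; [exact: d1|exact: IH d2].
Qed.

Lemma Ck_on_cst k U (a : R) : open U -> Ck_on k U (fun=> a).
Proof.
move=> oU; elim: k a => [|k IH] a; split=> //; try by move=> x _; exact: cst_continuous.
move=> i; split=> [x _|]; first exact: derivable_cst.
apply: Ck_on_eq (IH 0) => // x _; exact/esym/derive_cst.
Qed.

Lemma Ck_onD k U f g : open U -> Ck_on k U f -> Ck_on k U g ->
  Ck_on k U (fun x => f x + g x).
Proof.
move=> oU; elim: k f g => [|k IH] f g [cf df] [cg dg].
  by split=> // x Ux; apply: continuousD; [apply: cf|apply: cg].
split; first by move=> x Ux; apply: continuousD; [apply: cf|apply: cg].
move=> i; have [f1 f2] := df i; have [g1 g2] := dg i; split.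
  by move=> x Ux; apply: derivableD; [apply: f1|apply: g1].
apply: Ck_on_eq (IH _ _ f2 g2) => // x Ux.
by rewrite [RHS](deriveD (f1 x Ux) (g1 x Ux)).
Qed.

Lemma Ck_onM k U f g : open U -> Ck_on k U f -> Ck_on k U g ->
  Ck_on k U (fun x => f x * g x).
Proof.
move=> oU; elim: k f g => [|k IH] f g Cf Cg.
  case: Cf Cg => [cf _] [cg _].
  by split=> // x Ux; apply: continuousM; [apply: cf|apply: cg].
have := Ck_onW Cf; have := Ck_onW Cg.
case: Cf Cg => [cf df] [cg dg] Cg Cf; split.
  by move=> x Ux; apply: continuousM; [apply: cf|apply: cg].
move=> i; have [f1 f2] := df i; have [g1 g2] := dg i; split.
  by move=> x Ux; apply: derivableM; [apply: f1|apply: g1].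
apply: Ck_on_eq (Ck_onD oU (IH _ _ Cf g2) (IH _ _ Cg f2)) => // x Ux.
by rewrite [RHS](deriveM (f1 x Ux) (g1 x Ux)).
Qed.

End EuclideanSmooth.

(* A homeomorphism from the open set [cdom] onto the open set [cran]; the values
   of [cmap] and [cinv] outside these sets are irrelevant. *)
Record chart (R : realType) (n : nat) (T : topologicalType) := Chart {
  cdom : set T;
  cran : set 'rV[R]_n;
  cmap : T -> 'rV[R]_n;
  cinv : 'rV[R]_n -> T;
  cdom_open : open cdom;
  cran_open : open cran;
  cmap_ran : forall p, cdom p -> cran (cmap p);
  cinv_dom : forall x, cran x -> cdom (cinv x);
  cmapK : forall p, cdom p -> cinv (cmap p) = p;
  cinvK : forall x, cran x -> cmap (cinv x) = x;
  cmap_cont : forall p, cdom p -> {for p, continuous cmap};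
  cinv_cont : forall x, cran x -> {for x, continuous cinv} }.

(* The atlas need not be maximal: it determines the smooth structure. *)
Record manifold (R : realType) (n : nat) := Manifold {
  carrier :> topologicalType;
  atlas : set (chart R n carrier);
  manifold_hausdorff : hausdorff_space carrier;
  manifold_second_countable : @second_countable carrier;
  manifold_connected : connected [set: carrier];
  atlas_cover : forall p : carrier, exists2 c, atlas c & cdom c p;
  atlas_compat : forall c d, atlas c -> atlas d -> forall i : 'I_n,
    Cinfty_on (cran c `&` cinv c @^-1` cdom d)
              (fun x => cmap d (cinv c x) 0 i) }.

Section SmoothFunctions.
Context {R : realType} {n : nat} {Z : manifold R n}.
Implicit Types (U : set Z) (f g : Z -> R).

(* [U] is meant to be open; the values of [f] outside [U] are irrelevant. *)
Definition smooth_on U f : Prop := forall c, atlas c ->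
  Cinfty_on (cran c `&` cinv c @^-1` U) (fun x => f (cinv c x)).

Lemma chart_open U (c : chart R n Z) : open U ->
  open (cran c `&` cinv c @^-1` U).
Proof.
move=> oU; rewrite openE => x [cx Ux]; apply: filterI.
  by apply: open_nbhs_nbhs; split=> //; exact: cran_open.
by apply: (cinv_cont cx); apply: open_nbhs_nbhs.
Qed.

Lemma smooth_on_cst U (a : R) : open U -> smooth_on U (fun=> a).
Proof. by move=> oU c _ k; apply/Ck_on_cst/chart_open. Qed.

Lemma smooth_onD U f g : open U -> smooth_on U f -> smooth_on U g ->
  smooth_on U (fun p => f p + g p).
Proof.
by move=> oU sf sg c ac k; apply: Ck_onD; [exact: chart_open|exact: sf|exact: sg].
Qed.

Lemma smooth_onM U f g : open U -> smooth_on U f -> smooth_on U g ->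
  smooth_on U (fun p => f p * g p).
Proof.
by move=> oU sf sg c ac k; apply: Ck_onM; [exact: chart_open|exact: sf|exact: sg].
Qed.

Lemma smooth_onN U f : open U -> smooth_on U f -> smooth_on U (fun p => - f p).
Proof.
move=> oU sf; have := smooth_onM oU (smooth_on_cst (-1) oU) sf.
by congr smooth_on; apply/funext => p; rewrite mulN1r.
Qed.

Lemma smooth_onS U V f : U `<=` V -> smooth_on V f -> smooth_on U f.
Proof.
move=> UV sf c ac k; have := sf c ac k; move: (fun x => _) => h.
have WW : cran c `&` cinv c @^-1` U `<=` cran c `&` cinv c @^-1` V.
  by move=> x [? ?]; split=> //; apply: UV.
elim: k h => [|k IH] h [ch dh].
  by split=> // x /WW; exact: ch.
split=> [x /WW|i]; first exact: ch.
by have [d1 d2] := dh i; split=> [x /WW|]; [exact: d1|exact: IH].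
Qed.

Definition smooth_pred : {pred Z -> R} := fun f => `[< smooth_on setT f >].

Lemma smooth_pred_subring : subring_closed smooth_pred.
Proof.
split=> [|f g /asboolP sf /asboolP sg|f g /asboolP sf /asboolP sg]; apply/asboolP.
- by apply: smooth_on_cst; exact: openT.
- by apply: smooth_onD => //; [exact: openT|apply: smooth_onN => //; exact: openT].
- by apply: smooth_onM => //; exact: openT.
Qed.

End SmoothFunctions.

Record Cinfty (R : realType) (n : nat) (Z : manifold R n) := SmoothFun {
  cf_fun :> Z -> R;
  cf_smooth : cf_fun \in smooth_pred }.

Arguments cf_fun {R n Z}.

Section CinftyRing.
Context {R : realType} {n : nat} {Z : manifold R n}.

HB.instance Definition _ := [isSub of Cinfty Z for cf_fun].
HB.instance Definition _ := [Choice of Cinfty Z by <:].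
HB.instance Definition _ := GRing.SubChoice_isSubComPzRing.Build
  (Z -> R) smooth_pred (Cinfty Z) smooth_pred_subring.

Lemma cst_smooth_subproof (a : R) : (fun=> a) \in @smooth_pred R n Z.
Proof. by apply/asboolP/smooth_on_cst; exact: openT. Qed.

Definition cf_cst (a : R) : Cinfty Z := SmoothFun (cst_smooth_subproof a).

End CinftyRing.

Section VectorFields.
Context {R : realType} {n : nat} {Z : manifold R n}.
Implicit Types (p : Z) (f g : Cinfty Z).

(* Tangent vectors at [p] are the real derivations of $C^\infty(Z)$ at [p]. *)
Definition tangent_vector p (v : Cinfty Z -> R) : Prop :=
  [/\ forall f g, v (f + g) = v f + v g,
      forall a f, v (cf_cst a * f) = a * v f
    & forall f g, v (f * g) = f p * v g + g p * v f].

(* Smooth vector fields on an open subset [U], with junk values outside. Since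
   every germ extends to $Z$, testing smoothness of the components of [X] amounts
   to testing smoothness of [X f] on [U] for global [f]. *)
Definition vector_field_on (U : set Z) (X : Z -> Cinfty Z -> R) : Prop :=
  (forall p, U p -> tangent_vector p (X p)) /\
  (forall f, smooth_on U (fun p => X p f)).

End VectorFields.

Record vfield (R : realType) (n : nat) (Z : manifold R n) := VField {
  vf_fun :> Z -> Cinfty Z -> R;
  vfP : vector_field_on setT vf_fun }.

Section VectorFieldModule.
Context {R : realType} {n : nat} {Z : manifold R n}.
Implicit Types (p : Z) (f g : Cinfty Z) (X Y : vfield Z).

(* The function $X f = X\rfloor df$. *)
Definition vf_app X f : Cinfty Z :=
  SmoothFun (introT (asboolP _) ((vfP X).2 f) : _ \in smooth_pred).

Definition lie_bracket X Y p : Cinfty Z -> R :=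
  fun f => X p (vf_app Y f) - Y p (vf_app X f).

Lemma vfield_ext X Y : (forall p f, X p f = Y p f) -> X = Y.
Proof.
case: X Y => [X hX] [Y hY] /= E; have {}E : X = Y.
  by apply/funext => p; apply/funext => f; exact: E.
by case: Y / E hY => hY; congr VField; exact: Prop_irrelevance.
Qed.

Lemma vf0_subproof : vector_field_on setT (fun (p : Z) (_ : Cinfty Z) => 0 : R).
Proof.
split=> [p _|f]; last by apply: smooth_on_cst; exact: openT.
by split=> *; rewrite ?mulr0 ?addr0.
Qed.

Lemma vfD_subproof X Y : vector_field_on setT (fun p f => X p f + Y p f).
Proof.
case: X Y => [X [tX sX]] [Y [tY sY]] /=; split=> [p _|f].
  have [X1 X2 X3] := tX p I; have [Y1 Y2 Y3] := tY p I.
  split=> *; rewrite ?X1 ?Y1 ?X2 ?Y2 ?X3 ?Y3 ?mulrDr //.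
    by rewrite addrACA.
  by rewrite addrACA.
by apply: smooth_onD => //; exact: openT.
Qed.

Lemma vfN_subproof X : vector_field_on setT (fun p f => - X p f).
Proof.
case: X => [X [tX sX]] /=; split=> [p _|f].
  have [X1 X2 X3] := tX p I.
  by split=> *; rewrite ?X1 ?X2 ?X3 ?mulrN ?opprD.
by apply: smooth_onN => //; exact: openT.
Qed.

Lemma vfZ_subproof f X : vector_field_on setT (fun p g => f p * X p g).
Proof.
case: X => [X [tX sX]] /=; split=> [p _|g].
  have [X1 X2 X3] := tX p I; split=> *; rewrite ?X1 ?X2 ?X3 ?mulrDr //.
    by rewrite mulrCA.
  by congr +%R; rewrite mulrCA.
apply: smooth_onM => //; [exact: openT|exact/asboolP/(cf_smooth f)].
Qed.

HB.instance Definition _ := gen_eqMixin (vfield Z).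
HB.instance Definition _ := gen_choiceMixin (vfield Z).

Let vfD X Y := VField (vfD_subproof X Y).
Let vfN X := VField (vfN_subproof X).
Let vfZ f X := VField (vfZ_subproof f X).

Fact vfDA : associative vfD.
Proof. by move=> X Y W; apply: vfield_ext => p f /=; rewrite addrA. Qed.
Fact vfDC : commutative vfD.
Proof. by move=> X Y; apply: vfield_ext => p f /=; rewrite addrC. Qed.
Fact vf0D : left_id (VField vf0_subproof) vfD.
Proof. by move=> X; apply: vfield_ext => p f /=; rewrite add0r. Qed.
Fact vfND : left_inverse (VField vf0_subproof) vfN vfD.
Proof. by move=> X; apply: vfield_ext => p f /=; rewrite addNr. Qed.

HB.instance Definition _ := GRing.isZmodule.Build (vfield Z) vfDA vfDC vf0D vfND.

Fact vfZA f g X : vfZ f (vfZ g X) = vfZ (f * g) X.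
Proof. by apply: vfield_ext => p h /=; rewrite mulrA. Qed.
Fact vfZ1 : left_id 1 vfZ.
Proof. by move=> X; apply: vfield_ext => p h /=; rewrite mul1r. Qed.
Fact vfZDr : right_distributive vfZ +%R.
Proof. by move=> f X Y; apply: vfield_ext => p h /=; rewrite mulrDr. Qed.
Fact vfZDl X : {morph vfZ^~ X : f g / f + g}.
Proof. by move=> f g; apply: vfield_ext => p h /=; rewrite mulrDl. Qed.

HB.instance Definition _ :=
  GRing.Zmodule_isLmodule.Build (Cinfty Z) (vfield Z) vfZA vfZ1 vfZDr vfZDl.

End VectorFieldModule.

(* A foliation, whose leaves are the maximal integral manifolds of an involutive
   distribution, is given by this distribution $T\mathcal F$: [ftan p] is the
   subspace of vectors at [p] tangent to the leaf through [p]. It is a smooth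
   subbundle of rank [fdim], i.e. it has local smooth frames. *)
Record foliation (R : realType) (n : nat) (Z : manifold R n) := Foliation {
  fdim : nat;
  ftan : Z -> set (Cinfty Z -> R);
  ftan_frame : forall p, exists (U : set Z) (X : 'I_fdim -> Z -> Cinfty Z -> R),
    [/\ open U, U p, forall i, vector_field_on U (X i),
        forall q, U q -> forall a : 'I_fdim -> R,
          (forall f, \sum_(i < fdim) a i * X i q f = 0) -> forall i, a i = 0
      & forall q, U q -> forall v, ftan q v <->
          exists a : 'I_fdim -> R, forall f, v f = \sum_(i < fdim) a i * X i q f];
  ftan_involutive : forall X Y : vfield Z,
    (forall p, ftan p (X p)) -> (forall p, ftan p (Y p)) ->
    forall p, ftan p (lie_bracket X Y p) }.

Section LeafwiseFields.
Context {R : realType} {n : nat} {Z : manifold R n}.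
Implicit Type F : foliation Z.

Definition leafwise_pred F : {pred vfield Z} :=
  fun X => `[< forall p, ftan F p (X p) >].

Lemma leafwise_pred_submod F : subsemimod_closed (leafwise_pred F).
Proof.
have frame p := ftan_frame F p.
split; first split.
- apply/asboolP => p; have [U [X [_ Up _ _ H]]] := frame p.
  apply/(H p Up); exists (fun=> 0) => f.
  by rewrite big1 // => i _; rewrite mul0r.
- move=> A B /asboolP tA /asboolP tB; apply/asboolP => p.
  have [U [X [_ Up _ _ H]]] := frame p.
  have [a Ea] := (H p Up _).1 (tA p); have [b Eb] := (H p Up _).1 (tB p).
  apply/(H p Up); exists (fun i => a i + b i) => f.
  rewrite [LHS](_ : _ = A p f + B p f) // Ea Eb -big_split /=.
  by apply: eq_bigr => i _; rewrite mulrDl.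
- move=> g A /asboolP tA; apply/asboolP => p.
  have [U [X [_ Up _ _ H]]] := frame p; have [a Ea] := (H p Up _).1 (tA p).
  apply/(H p Up); exists (fun i => g p * a i) => f.
  rewrite [LHS](_ : _ = g p * A p f) // Ea mulr_sumr.
  by apply: eq_bigr => i _; rewrite mulrA.
Qed.

End LeafwiseFields.

(* Global sections of $T\mathcal F$. *)
Record leafwise_vfield (R : realType) (n : nat) (Z : manifold R n)
    (F : foliation Z) := LeafwiseVField {
  lvf_val :> vfield Z;
  lvf_tangent : lvf_val \in leafwise_pred F }.

Arguments lvf_val {R n Z F}.

Section LeafwiseModule.
Context {R : realType} {n : nat} {Z : manifold R n} (F : foliation Z).

HB.instance Definition _ := [isSub of leafwise_vfield F for lvf_val].
HB.instance Definition _ := [Choice of leafwise_vfield F by <:].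
HB.instance Definition _ := GRing.SubChoice_isSubLmodule.Build (Cinfty Z)
  (vfield Z) (leafwise_pred F) (leafwise_vfield F) (leafwise_pred_submod F).

End LeafwiseModule.

Section ComplexSmooth.
Context {R : realType} {n : nat} {Z : manifold R n}.
Implicit Types (U : set Z) (f g : Z -> R[i]).

Definition csmooth_on U g : Prop :=
  smooth_on U (fun p => complex.Re (g p)) /\
  smooth_on U (fun p => complex.Im (g p)).

Lemma csmooth_on_cst U (a : R[i]) : open U -> csmooth_on U (fun=> a).
Proof. by move=> oU; split; exact: smooth_on_cst. Qed.

Lemma csmooth_onD U f g : open U -> csmooth_on U f -> csmooth_on U g ->
  csmooth_on U (fun p => f p + g p).
Proof.
move=> oU [f1 f2] [g1 g2]; split.
  have := smooth_onD oU f1 g1; congr smooth_on; apply/funext => p.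
  by case: (f p) (g p) => ? ? [].
have := smooth_onD oU f2 g2; congr smooth_on; apply/funext => p.
by case: (f p) (g p) => ? ? [].
Qed.

Lemma csmooth_onM U f g : open U -> csmooth_on U f -> csmooth_on U g ->
  csmooth_on U (fun p => f p * g p).
Proof.
move=> oU [f1 f2] [g1 g2]; split.
  have := smooth_onD oU (smooth_onM oU f1 g1) (smooth_onN oU (smooth_onM oU f2 g2)).
  by congr smooth_on; apply/funext => p; case: (f p) (g p) => ? ? [].
have := smooth_onD oU (smooth_onM oU f1 g2) (smooth_onM oU f2 g1).
by congr smooth_on; apply/funext => p; case: (f p) (g p) => ? ? [].
Qed.

End ComplexSmooth.

(* A local trivialization over [tdom] of a family of complex vector spaces; the
   maps [tmap p] for [p] outside [tdom] are irrelevant. *)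
Record trivialization (R : realType) (n : nat) (Z : manifold R n)
    (E : Z -> lmodType R[i]) := Trivialization {
  tdom : set Z;
  tmap : forall p, {linear E p -> R[i]^o};
  tdom_open : open tdom;
  tmap_bij : forall p, tdom p -> bijective (tmap p) }.

(* A smooth complex line bundle, presented by its fibres and by an atlas of
   fibrewise linear trivializations with smooth transition functions; this
   determines the smooth structure of the total space. *)
Record line_bundle (R : realType) (n : nat) (Z : manifold R n) := LineBundle {
  fibre :> Z -> lmodType R[i];
  triv_atlas : set (trivialization fibre);
  triv_cover : forall p, exists2 t, triv_atlas t & tdom t p;
  triv_compat : forall t u, triv_atlas t -> triv_atlas u ->
    exists2 g : Z -> R[i], csmooth_on (tdom t `&` tdom u) g &
      forall p, tdom t p -> tdom u p ->
        forall e : fibre p, tmap u p e = g p * tmap t p e }.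

Section Sections.
Context {R : realType} {n : nat} {Z : manifold R n}.

Definition smooth_section (C : line_bundle Z) (s : forall p, C p) : Prop :=
  forall t : trivialization C, triv_atlas t ->
    csmooth_on (tdom t) (fun p => tmap t p (s p)).

End Sections.

Record gsection (R : realType) (n : nat) (Z : manifold R n)
    (C : line_bundle Z) := GSection {
  gs_fun :> forall p, C p;
  gs_smooth : smooth_section gs_fun }.

Section SectionSpace.
Context {R : realType} {n : nat} {Z : manifold R n} {C : line_bundle Z}.
Implicit Types (s t u : gsection C) (a b : R[i]) (f : Cinfty Z).

Lemma gsection_ext s t : (forall p, s p = t p) -> s = t.
Proof.
case: s t => [s hs] [t ht] /= E; have {}E : s = t by exact: functional_extensionality_dep.
by case: t / E ht => ht; congr GSection; exact: Prop_irrelevance.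
Qed.

Lemma gs0_subproof : smooth_section (fun p => 0 : C p).
Proof.
move=> t _; have := csmooth_on_cst 0 (@tdom_open _ _ _ _ t).
by congr csmooth_on; apply/funext => p; rewrite linear0.
Qed.

Lemma gsD_subproof s t : smooth_section (fun p => s p + t p).
Proof.
move=> w aw; have := csmooth_onD (@tdom_open _ _ _ _ w)
  (gs_smooth s aw) (gs_smooth t aw).
by congr csmooth_on; apply/funext => p; rewrite linearD.
Qed.

Lemma gsM_subproof (g : Z -> R[i]) s : csmooth_on setT g ->
  smooth_section (fun p => g p *: s p).
Proof.
move=> [g1 g2] w aw; have gw : csmooth_on (tdom w) g.
  by split; [apply: smooth_onS g1|apply: smooth_onS g2].
have := csmooth_onM (@tdom_open _ _ _ _ w) gw (gs_smooth s aw).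
by congr csmooth_on; apply/funext => p; rewrite linearZ.
Qed.

Lemma csmooth_cf f : csmooth_on setT (fun p => ((f p)%:C)%C).
Proof.
split; first exact/asboolP/(cf_smooth f).
by apply: smooth_on_cst; exact: openT.
Qed.

HB.instance Definition _ := gen_eqMixin (gsection C).
HB.instance Definition _ := gen_choiceMixin (gsection C).

Let gs0 := GSection gs0_subproof.
Let gsD s t := GSection (gsD_subproof s t).
Let gsZ a s := GSection (gsM_subproof s (csmooth_on_cst a openT)).
Let gsN s := gsZ (-1) s.

Fact gsDA : associative gsD.
Proof. by move=> s t u; apply: gsection_ext => p /=; rewrite addrA. Qed.
Fact gsDC : commutative gsD.
Proof. by move=> s t; apply: gsection_ext => p /=; rewrite addrC. Qed.
Fact gs0D : left_id gs0 gsD.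
Proof. by move=> s; apply: gsection_ext => p /=; rewrite add0r. Qed.
Fact gsND : left_inverse gs0 gsN gsD.
Proof. by move=> s; apply: gsection_ext => p /=; rewrite scaleN1r addNr. Qed.

HB.instance Definition _ := GRing.isZmodule.Build (gsection C) gsDA gsDC gs0D gsND.

Fact gsZA a b s : gsZ a (gsZ b s) = gsZ (a * b) s.
Proof. by apply: gsection_ext => p /=; rewrite scalerA. Qed.
Fact gsZ1 : left_id 1 gsZ.
Proof. by move=> s; apply: gsection_ext => p /=; rewrite scale1r. Qed.
Fact gsZDr : right_distributive gsZ +%R.
Proof. by move=> a s t; apply: gsection_ext => p /=; rewrite scalerDr. Qed.
Fact gsZDl s : {morph gsZ^~ s : a b / a + b}.
Proof. by move=> a b; apply: gsection_ext => p /=; rewrite scalerDl. Qed.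

HB.instance Definition _ :=
  GRing.Zmodule_isLmodule.Build R[i] (gsection C) gsZA gsZ1 gsZDr gsZDl.

Definition fscale f s : gsection C := GSection (gsM_subproof s (csmooth_cf f)).

End SectionSpace.

(* Covariant derivatives along the vector fields [rho X], for [X] ranging over
   a $C^\infty(Z)$-module [M]. Linearity of the connection makes each [nabla X]
   a complex-linear endomorphism of the space of sections. *)
Record covariant_derivative (R : realType) (n : nat) (Z : manifold R n)
    (C : line_bundle Z) (M : lmodType (Cinfty Z)) (rho : M -> vfield Z) :=
  CovariantDerivative {
  nabla :> M -> gsection C -> gsection C;
  nabla_vfield_linear : forall (f : Cinfty Z) (X Y : M) (s : gsection C),
    nabla (f *: X + Y) s = fscale f (nabla X s) + nabla Y s;
  nabla_section_linear : forall (X : M) (a : R[i]) (s t : gsection C),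
    nabla X (a *: s + t) = a *: nabla X s + nabla X t;
  nabla_leibniz : forall (X : M) (f : Cinfty Z) (s : gsection C),
    nabla X (fscale f s) = fscale (vf_app (rho X) f) s + fscale f (nabla X s) }.

(* Connections are represented by their covariant derivatives: in a local
   trivialization, the horizontal splitting $dz^a\otimes(\partial_a +
   \Gamma_a c\,\partial_c)$ corresponds to
   $\nabla_X s = X\rfloor ds - X^a\Gamma_a s$, and likewise leafwise. *)
Definition linear_connection (R : realType) (n : nat) (Z : manifold R n)
    (C : line_bundle Z) := covariant_derivative C (fun X : vfield Z => X).

Definition leafwise_connection (R : realType) (n : nat) (Z : manifold R n)
    (F : foliation Z) (C : line_bundle Z) :=
  covariant_derivative C (fun X : leafwise_vfield F => lvf_val X).

Section InducedConnection.
Context {R : realType} {n : nat} {Z : manifold R n}.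
Variables (F : foliation Z) (C : line_bundle Z) (G : linear_connection C).

Fact induced_vfield_linear (f : Cinfty Z) (X Y : leafwise_vfield F)
    (s : gsection C) :
  G (lvf_val (f *: X + Y)) s = fscale f (G (lvf_val X) s) + G (lvf_val Y) s.
Proof. exact: nabla_vfield_linear. Qed.

Definition induced_leafwise : leafwise_connection F C :=
  @CovariantDerivative R n Z C (leafwise_vfield F) _
    (fun X => G (lvf_val X)) induced_vfield_linear
    (fun X => nabla_section_linear G (lvf_val X))
    (fun X => nabla_leibniz G (lvf_val X)).

End InducedConnection.

(* Main.v *)
Require Import Defs.
From mathcomp Require Import all_boot all_order all_algebra.
From mathcomp Require Import all_classical all_reals.
From mathcomp Require Import complex.
From mathcomp Require Import topology normedtype sequences derive realfun exp.
From mathcomp Require Import ring.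

(* Near each point there are a C^infinity(Z)-linear map P from vector fields to
   leafwise ones with P X = b X for leafwise X, and an operator D on sections
   that is a connection up to a factor a: D_X(fs) = a (Xf) s + f D_X s; here a
   and b are bump functions. The operator b D_X s + a A_{PX} s - D_{PX} s is then
   a connection up to the factor ab and equals ab A on leafwise fields. Such
   operators D_k with weights h_k, each point having a neighbourhood on which
   some h_k = 1, are glued by G = sum_k (1 - h_0)...(1 - h_{k-1}) D_k: the sum is
   locally finite and its total weight telescopes to 1. *)

Set Implicit Arguments.
Unset Strict Implicit.
Unset Printing Implicit Defensive.

Import Order.TTheory GRing.Theory Num.Theory.
Import numFieldNormedType.Exports.

Local Open Scope classical_set_scope.
Local Open Scope ring_scope.

(** * Smooth bump functions *)

Lemma derive_line (R : numFieldType) (V W : normedModType R) (f : V -> W)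
    (x v : V) : 'D_v f x = 'D_1 (fun h : R => f (h *: v + x)) 0.
Proof.
rewrite /derive; set g1 := fun h => h^-1 *: _; set g2 := fun h => h^-1 *: _.
suff -> : g1 = g2 by [].
by apply/funext => h; rewrite /g1 /g2 /= addr0 scale0r add0r [h *: 1]mulr1.
Qed.

(** Restricting [f] to the line through [x] in direction [v] reduces this to the one-variable chain
    rule, which suits the directional derivatives in [Ck_on]. *)
Lemma is_derive_comp (R : realType) (V : normedModType R) (g : R -> R)
    (f : V -> R^o) (x v : V) (a b : R) :
  is_derive (f x) 1 g a -> is_derive x v f b ->
  is_derive x v (fun y => g (f y)) (a * b).
Proof.
move=> dg [df <-]; set u := fun h : R => f (h *: v + x).
have u0 : u 0 = f x by rewrite /u scale0r add0r.
have dg' : is_derive (u 0) 1 g a by rewrite u0.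
have du : is_derive (0 : R) 1 u ('D_v f x).
  by apply: DeriveDef; [exact: (derivable1P f x v).1|rewrite [RHS]derive_line].
have [d1 d2] := is_derive1_comp dg' du; apply: DeriveDef.
  exact: (derivable1P (fun y => g (f y) : R^o) x v).2.
by rewrite [LHS]derive_line; exact: d2.
Qed.

(** For [k = 0] this is the classical flat function $e^{-1/x}$ extended by zero. The powers of
    [x^-1] make the span of the family closed under differentiation. *)
Definition flat_exp (R : realType) (k : nat) (x : R) : R :=
  if 0 < x then x^-1 ^+ k * expR (- x^-1) else 0.

(* The exponential beats [(x^-1)^(k+1)] because [e^t >= (t/m)^m]. *)
Lemma flat_exp_le (R : realType) (k : nat) (x : R) : 0 < x ->
  x^-1 * flat_exp k x <= k.+2%:R ^+ k.+2 * x.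
Proof.
move=> x0; rewrite /flat_exp x0 mulrA -exprS.
set t := x^-1; have t0 : 0 < t by rewrite invr_gt0.
have h : (t / k.+2%:R) ^+ k.+2 <= expR t.
  have -> : expR t = expR (t / k.+2%:R) ^+ k.+2.
    by rewrite -expRM_natl mulrC divfK// pnatr_eq0.
  apply: lerXn2r; rewrite ?nnegrE ?expR_ge0 ?divr_ge0 ?ler0n ?(ltW t0)//.
  by apply: le_trans (expR_ge1Dx _); rewrite lerDr.
rewrite expRN ler_pdivrMr ?expR_gt0//.
have -> : t ^+ k.+1 = k.+2%:R ^+ k.+2 * x * (t / k.+2%:R) ^+ k.+2.
  have m0 : (k.+2%:R : R) ^+ k.+2 != 0 by rewrite expf_neq0 ?pnatr_eq0.
  have tx : x * t = 1 by rewrite mulfV// gt_eqF.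
  by rewrite expr_div_n mulrA -[_ * x * _]mulrA [_ * (x * _)]mulrC mulfK// [t ^+ k.+2]exprS
    mulrA tx mul1r.
by rewrite ler_wpM2l// mulr_ge0 ?exprn_ge0 ?ler0n ?(ltW x0).
Qed.

Lemma flat_exp_ge0 (R : realType) (k : nat) (x : R) : 0 <= flat_exp k x.
Proof.
rewrite /flat_exp; case: ifP => // x0.
by rewrite mulr_ge0 ?expR_ge0// exprn_ge0// invr_ge0 ltW.
Qed.

Lemma flat_exp_gt0 (R : realType) (k : nat) (x : R) : 0 < x -> 0 < flat_exp k x.
Proof. by move=> x0; rewrite /flat_exp x0 mulr_gt0 ?expR_gt0// exprn_gt0// invr_gt0. Qed.

Lemma flat_exp_eq0 (R : realType) (k : nat) (x : R) : x <= 0 -> flat_exp k x = 0.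
Proof. by move=> x0; rewrite /flat_exp ltNge x0. Qed.

Lemma is_derive_flat_exp (R : realType) (k : nat) (x : R) :
  is_derive x 1 (@flat_exp R k) (- k%:R * flat_exp k.+1 x + flat_exp k.+2 x).
Proof.
have [x0|x0|->] := ltgtP x 0.
- rewrite !flat_exp_eq0 ?(ltW x0)// mulr0 addr0.
  have nz : \forall y \near x, (cst 0 : R -> R) y = flat_exp k y.
    near=> y; rewrite flat_exp_eq0// ltW//; near: y; exact: lt_nbhsl.
  have dc : derivable (cst 0 : R -> R) x 1 by exact: derivable_cst.
  apply: DeriveDef; first exact: near_eq_derivable nz dc.
  by rewrite -(near_eq_derive _ nz) derive_cst.
- pose g := fun y : R => y^-1 ^+ k * expR (- y^-1).
  have nz : \forall y \near x, g y = flat_exp k y.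
    near=> y; rewrite /flat_exp ifT//; near: y; exact: lt_nbhsr.
  have xn : x != 0 by rewrite gt_eqF.
  have dg : is_derive x 1 g (- k%:R * flat_exp k.+1 x + flat_exp k.+2 x).
    have di : is_derive x 1 (fun y : R => y^-1) (- x ^- 2).
      have := @is_deriveV R id x 1 1 xn (is_derive_id _ _).
      by rewrite /GRing.scale /= mulr1.
    have dn : is_derive x 1 (fun y : R => - y^-1) (- - x ^- 2) by exact: is_deriveN di.
    have de := @is_derive1_comp _ (@expR R) (fun y => - y^-1) _ _ _ (is_derive_expR _) dn.
    have dp : is_derive x 1 (fun y : R => y^-1 ^+ k) (k%:R * x^-1 ^+ k.-1 * - x ^- 2).
      by have := @is_deriveX _ _ (fun y : R => y^-1) k x 1 _ di; rewrite exprfctE.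
    have := is_deriveM dp de; set d := (X in is_derive _ _ _ X -> _).
    have -> // : d = - k%:R * flat_exp k.+1 x + flat_exp k.+2 x.
    rewrite /d /flat_exp x0 /GRing.scale /= opprK -!exprVn; set e := expR _.
    by case: k {g nz d dp} => [|k] /=; rewrite ?exprS; ring.
  case: dg => d1 d2; apply: DeriveDef; first exact: near_eq_derivable nz d1.
  by rewrite -(near_eq_derive _ nz).
rewrite !flat_exp_eq0// mulr0 addr0.
(* At 0 the difference quotient vanishes for [h < 0] and is at most [m * h] for [h > 0], by
   [flat_exp_le]. *)
suff lim0 : (fun h : R => h^-1 *: ((@flat_exp R k \o shift 0) (h *: 1) - flat_exp k 0))
    @ 0^' --> (0 : R).
  by apply: DeriveDef; [apply: cvgP lim0|apply: cvg_lim lim0].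
pose m : R := k.+2%:R ^+ k.+2.
have m0 : 0 <= m by rewrite exprn_ge0.
apply/cvgrPdist_le => e e0; near=> h.
rewrite sub0r normrN /= addr0 [flat_exp k 0]flat_exp_eq0// subr0 [h *: 1]mulr1.
rewrite /GRing.scale /=; have [h0|h0] := ltP 0 h; last first.
  by rewrite flat_exp_eq0// mulr0 normr0 ltW.
rewrite ger0_norm; last by rewrite mulr_ge0 ?flat_exp_ge0// invr_ge0 ltW.
apply: le_trans (flat_exp_le k h0) _; rewrite -/m.
apply: (@le_trans _ _ ((m + 1) * h)); first by rewrite ler_wpM2r ?(ltW h0)// lerDl.
rewrite mulrC -ler_pdivlMr; last by rewrite ltr_wpDl.
rewrite -[leLHS]ger0_norm ?(ltW h0)//; near: h.
apply: dnbhs0_le; rewrite divr_gt0// ltr_wpDl//.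
Unshelve. all: by end_near. Qed.

Lemma continuous_flat_exp (R : realType) (k : nat) : continuous (@flat_exp R k).
Proof.
move=> x; apply: differentiable_continuous; apply/derivable1_diffP.
by have [] := is_derive_flat_exp k x.
Qed.

(** Induction on [m] with [k] general, since differentiating raises [k] by one and by two. *)
Lemma Ck_on_flat_exp (R : realType) (n m k : nat) (U : set 'rV[R]_n)
    (f : 'rV[R]_n -> R^o) : open U ->
  Ck_on m U f -> Ck_on m U (fun x => flat_exp k (f x)).
Proof.
move=> oU; elim: m k f => [|m IH] k f Cf.
  by split=> // x Ux; apply: continuous_comp; [exact: Cf.1|exact: continuous_flat_exp].
have Cf' := Ck_onW Cf; split.
  by move=> x Ux; apply: continuous_comp; [exact: Cf.1|exact: continuous_flat_exp].
move=> i; have [d1 d2] := Cf.2 i.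
have D x (Ux : U x) := is_derive_comp (is_derive_flat_exp k (f x)) (derivableP (d1 x Ux)).
split=> [x Ux|]; first by have [] := D x Ux.
apply: (@Ck_on_eq _ _ _ _ (fun x =>
  (- k%:R * flat_exp k.+1 (f x) + flat_exp k.+2 (f x)) * 'D_(delta_mx 0 i) f x)) => //.
  by move=> x Ux; have [_ ->] := D x Ux.
apply: Ck_onM => //; apply: Ck_onD => //; last exact: IH.
by apply: Ck_onM => //; [exact: Ck_on_cst|exact: IH].
Qed.

(** * Inverses, sums, products and determinants of smooth functions *)

Lemma Ck_onV (R : realType) (n m : nat) (U : set 'rV[R]_n) (f : 'rV[R]_n -> R^o) :
  open U -> (forall x, U x -> f x != 0) ->
  Ck_on m U f -> Ck_on m U (fun x => (f x)^-1).
Proof.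
move=> oU f0; elim: m => [|m IH] Cf.
  by split=> // x Ux; apply: continuousV; [exact: f0|exact: Cf.1].
have Cf' := IH (Ck_onW Cf); split.
  by move=> x Ux; apply: continuousV; [exact: f0|exact: Cf.1].
move=> i; have [d1 d2] := Cf.2 i; split=> [x Ux|].
  by apply: derivableV; [exact: f0|exact: d1].
apply: (@Ck_on_eq _ _ _ _ (fun x =>
  -1 * ((f x)^-1 * (f x)^-1) * 'D_(delta_mx 0 i) f x)) => //.
  move=> x Ux; rewrite [RHS](deriveV (f0 x Ux) (d1 x Ux)) mulN1r /GRing.scale /=.
  by rewrite -exprVn expr2.
by do 2![apply: Ck_onM => //]; [exact: Ck_on_cst|exact: Ck_onM].
Qed.

(** Every clause of [Ck_on] concerns a single point and derivatives of the same [f], so each point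
    may bring a set [W] of its own. *)
Lemma Ck_on_local (R : realType) (n m : nat) (U : set 'rV[R]_n) (f : 'rV[R]_n -> R^o) :
  (forall x, U x -> exists2 W : set 'rV[R]_n, W x & Ck_on m W f) -> Ck_on m U f.
Proof.
elim: m f => [|m IH] f H.
  by split=> // x /H [W Wx [cf _]]; exact: cf.
split=> [x /H [W Wx [cf _]]|i]; first exact: cf.
split=> [x /H [W Wx [_ /(_ i)[d1 _]]]|]; first exact: d1.
by apply: IH => x /H [W Wx [_ /(_ i)[_ d2]]]; exists W.
Qed.

Lemma smooth_on_flat_exp (R : realType) (n k : nat) (Z : manifold R n) (U : set Z)
    (f : Z -> R) : open U -> smooth_on U f -> smooth_on U (fun p => flat_exp k (f p)).
Proof.
move=> oU sf c ac m; apply: Ck_on_flat_exp; [exact: chart_open|exact: sf].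
Qed.

Lemma smooth_onV (R : realType) (n : nat) (Z : manifold R n) (U : set Z) (f : Z -> R) :
  open U -> (forall p, U p -> f p != 0) -> smooth_on U f ->
  smooth_on U (fun p => (f p)^-1).
Proof.
move=> oU f0 sf c ac m; apply: Ck_onV; [exact: chart_open|by move=> x []; auto|exact: sf].
Qed.

Lemma smooth_on_local (R : realType) (n : nat) (Z : manifold R n) (U : set Z) (f : Z -> R) :
  (forall p, U p -> exists2 W : set Z, W p & smooth_on W f) -> smooth_on U f.
Proof.
move=> H c ac m; apply: Ck_on_local => x [cx /H [W Wx sf]].
by exists (cran c `&` cinv c @^-1` W); [split|exact: sf].
Qed.

Lemma smooth_on_eq (R : realType) (n : nat) (Z : manifold R n) (U : set Z) (f g : Z -> R) :
  open U -> (forall p, U p -> f p = g p) -> smooth_on U f -> smooth_on U g.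
Proof.
move=> oU fg sf c ac m; apply: Ck_on_eq (sf c ac m); first exact: chart_open.
by move=> x [_ Ux]; exact: fg.
Qed.

Lemma smooth_on_sum (R : realType) (n : nat) (Z : manifold R n) (U : set Z)
    (I : Type) (r : seq I) (P : pred I) (F : I -> Z -> R) : open U ->
  (forall i, smooth_on U (F i)) -> smooth_on U (fun p => \sum_(i <- r | P i) F i p).
Proof.
move=> oU sF; elim: r => [|i r IH].
  by apply: smooth_on_eq (smooth_on_cst 0 oU) => // p _; rewrite big_nil.
apply: (@smooth_on_eq _ _ _ _ (fun p => (if P i then F i p else 0) +
    \sum_(j <- r | P j) F j p)) => //.
  by move=> p _; rewrite big_cons; case: (P i); rewrite ?add0r.
by apply: smooth_onD => //; case: (P i) => //; exact: smooth_on_cst.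
Qed.

Lemma smooth_on_prod (R : realType) (n : nat) (Z : manifold R n) (U : set Z)
    (I : Type) (r : seq I) (F : I -> Z -> R) : open U ->
  (forall i, smooth_on U (F i)) -> smooth_on U (fun p => \prod_(i <- r) F i p).
Proof.
move=> oU sF; elim: r => [|i r IH].
  by apply: smooth_on_eq (smooth_on_cst 1 oU) => // p _; rewrite big_nil.
apply: (@smooth_on_eq _ _ _ _ (fun p => F i p * \prod_(j <- r) F j p)) => //.
  by move=> p _; rewrite big_cons.
exact: smooth_onM.
Qed.

Lemma smooth_on_det (R : realType) (n d : nat) (Z : manifold R n) (U : set Z)
    (M : Z -> 'M[R]_d) : open U ->
  (forall i j, smooth_on U (fun p => M p i j)) -> smooth_on U (fun p => \det (M p)).
Proof.
move=> oU sM; apply: smooth_on_sum => // s; apply: smooth_onM => //.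
  exact: smooth_on_cst.
exact: smooth_on_prod.
Qed.

Lemma smooth_on_continuous (R : realType) (n : nat) (Z : manifold R n) (U : set Z)
    (f : Z -> R) (p : Z) : open U -> U p -> smooth_on U f -> {for p, continuous f}.
Proof.
move=> oU Up sf; have [c ac cp] := atlas_cover p.
have [cf _] := sf c ac 0%N; have := cf (cmap c p).
rewrite /preimage /= /setI /= cmapK// => /(_ (conj (cmap_ran cp) Up)) cf'.
have := continuous_comp (cmap_cont cp) cf'.
rewrite /prop_for /continuous_at /= cmapK//; apply: cvg_trans.
apply: near_eq_cvg; apply: filterS (open_nbhs_nbhs (conj (cdom_open c) cp)) => q cq.
by rewrite /= cmapK.
Qed.

(** A point of [V] lying in [K] has [U] around it, where [f] is smooth; any other point has the open
    complement of [K], where [f] vanishes. *)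
Lemma smooth_on_extend0 (R : realType) (n : nat) (Z : manifold R n) (U V K : set Z)
    (f : Z -> R) : open U -> open V -> closed K -> V `&` K `<=` U ->
  (forall p, ~ K p -> f p = 0) -> smooth_on U f -> smooth_on V f.
Proof.
move=> oU oV cK KU f0 sf; apply: smooth_on_local => p Vp.
have [Kp|Kp] := pselect (K p); first by exists U => //; exact: KU.
have oK : open (~` K) by exact: closed_openC.
exists (~` K) => //; apply: smooth_on_eq (smooth_on_cst 0 oK) => // q Kq.
by rewrite f0.
Qed.

(** * Supports and bump functions *)

Definition supported_in (R : realType) (n : nat) (Z : manifold R n) (U : set Z)
    (h : Z -> R) : Prop :=
  exists K : set Z, [/\ closed K, K `<=` U & forall q, ~ K q -> h q = 0].

Lemma Cinfty_smooth (R : realType) (n : nat) (Z : manifold R n) (U : set Z)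
  (f : Cinfty Z) : smooth_on U f.
Proof. by apply: (@smooth_onS _ _ _ _ setT) => //; exact/asboolP/(cf_smooth f). Qed.

Lemma smooth_on_coord (R : realType) (n : nat) (Z : manifold R n)
    (c : chart R n Z) (i : 'I_n) : atlas c ->
  smooth_on (cdom c) (fun q => cmap c q 0 i).
Proof. by move=> ac d ad; exact: atlas_compat. Qed.

(** The bump is a quotient of flat functions of the squared coordinate distance to [p], descending
    from 1 to 0 between the levels [a] and [b], and extended by zero outside the chart. *)
Lemma smooth_bump (R : realType) (n : nat) (Z : manifold R n) (U : set Z) (p : Z) :
  open U -> U p ->
  exists h : Cinfty Z, (\forall q \near p, h q = 1) /\ supported_in U h.
Proof.
move=> oU Up; have [c ac cp] := atlas_cover p.
have nO : nbhs (cmap c p) (cran c `&` cinv c @^-1` U).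
  apply: open_nbhs_nbhs; split; first exact: chart_open.
  by split; [exact: cmap_ran|rewrite /= cmapK].
have [e /= e0 eO] := (nbhs_ballP _ _).1 nO.
set x0 := cmap c p in e0 eO; pose r := e / 2.
have r0 : 0 < r by rewrite divr_gt0.
have re : r < e by rewrite ltr_pdivrMr// ltr_pMr// ltr1n.
(* In the sup norm of row vectors this closed cube lies in the ball of radius [e]; it is compact as
   a product of segments. *)
pose B := [set x : 'rV[R]_n | forall i, `[x0 ord0 i - r, x0 ord0 i + r]%classic (x ord0 i)].
have BO : B `<=` cran c `&` cinv c @^-1` U.
  move=> x Bx; apply: eO; split=> // j i; rewrite (ord1 j).
  have /= := Bx i; rewrite in_itv /= => h.
  by apply: le_lt_trans re; rewrite distrC ler_distl.
have cB : compact B.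
  have := @rV_compact _ _ (fun i => `[x0 ord0 i - r, x0 ord0 i + r]%classic).
  by apply => i; exact: segment_compact.
pose K := cinv c @` B.
have cK : compact K.
  apply: continuous_compact cB; apply: continuous_in_subspaceT => x.
  by rewrite inE => /BO [cx _]; exact: cinv_cont.
(* Hausdorffness makes the compact image closed in all of [Z], so that the extension by zero outside
   the chart is smooth. *)
have clK : closed K by apply: compact_closed cK; exact: manifold_hausdorff.
have KU : K `<=` U by move=> _ [x /BO[_ Ux] <-].
have Kc : K `<=` cdom c by move=> _ [x /BO[cx _] <-]; exact: cinv_dom.
pose s q := \sum_(i < n) (cmap c q 0 i - x0 0 i) ^+ 2.
have ss : smooth_on (cdom c) s.
  have oc := @cdom_open _ _ _ c.
  apply: smooth_on_sum => // i; have sc := smooth_on_coord i ac.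
  have sd := smooth_onD oc sc (smooth_on_cst (- x0 0 i) oc).
  exact: (smooth_onM oc sd sd).
have s_le q i : (cmap c q 0 i - x0 0 i) ^+ 2 <= s q.
  by rewrite /s (bigD1 i)//= lerDl sumr_ge0// => j _; rewrite sqr_ge0.
(* Outside the cube some coordinate differs by more than [r], so the sum of squares is at least
   [r ^+ 2]. *)
have sK q : cdom c q -> ~ K q -> r ^+ 2 <= s q.
  move=> cq; apply: contra_notT; rewrite -ltNge => sr.
  exists (cmap c q); last exact: cmapK.
  move=> i /=; rewrite in_itv /= -ler_distl.
  have := le_lt_trans (s_le q i) sr.
  by rewrite -[(_ - _) ^+ 2]real_normK ?num_real// ltr_pXn2r// ?nnegrE ?(ltW r0)// => /ltW.
pose a := r ^+ 2 / 2; pose b := r ^+ 2.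
have ab : a < b by rewrite /a ltr_pdivrMr// ltr_pMr ?exprn_gt0// ltr1n.
pose den t := flat_exp 0 (b - t) + flat_exp 0 (t - a).
(* As [a < b], at every [t] one of the two summands is positive. *)
have den0 t : den t != 0.
  have [ta|ta] := leP t a.
    by rewrite gt_eqF// ltr_pwDl ?flat_exp_ge0// flat_exp_gt0// subr_gt0 (le_lt_trans ta).
  by rewrite gt_eqF// ltr_wpDl ?flat_exp_ge0// flat_exp_gt0// subr_gt0.
pose h q := if q \in cdom c then flat_exp 0 (b - s q) / den (s q) else 0.
have hK q : ~ K q -> h q = 0.
  move=> nK; rewrite /h; case: ifP => //; rewrite inE => cq.
  by rewrite flat_exp_eq0 ?mul0r// subr_le0 sK.
have sh : h \in smooth_pred.
  apply/asboolP; have oc := @cdom_open _ _ _ c.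
  apply: (smooth_on_extend0 oc openT clK _ hK); first by move=> q [_ /Kc].
  apply: (@smooth_on_eq _ _ _ _ (fun q => flat_exp 0 (b - s q) / den (s q))) => //.
    by move=> q cq; rewrite /h ifT// inE.
  have s1 : smooth_on (cdom c) (fun q => flat_exp 0 (b - s q)).
    apply: smooth_on_flat_exp => //; apply: smooth_onD => //; first exact: smooth_on_cst.
    exact: smooth_onN.
  apply: smooth_onM => //; apply: smooth_onV => //; apply: smooth_onD => //.
  apply: smooth_on_flat_exp => //; apply: smooth_onD => //; exact: smooth_on_cst.
exists (SmoothFun sh); split; last by exists K.
have s0 : s p = 0 by rewrite /s big1// => i _; rewrite subrr expr0n.
have : \forall q \near p, s q < a.
  have cs := smooth_on_continuous (cdom_open c) cp ss.
  have na : nbhs (s p) [set t | t < a].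
    by rewrite s0; apply: lt_nbhsl; rewrite divr_gt0// exprn_gt0.
  exact: (cs _ na).
apply: filterS2 (open_nbhs_nbhs (conj (cdom_open c) cp)) => q cq sa /=.
rewrite /h ifT ?inE//; have d0 := den0 (s q); move: d0; rewrite /den.
rewrite [X in _ + X]flat_exp_eq0 ?addr0 ?subr_le0 ?(ltW sa)// => d0.
by rewrite divff.
Qed.

(** By second countability: every basic open set on which some member of [H] equals 1 selects such a
    member, and an injection of the basis into [nat] numbers them. The zero function fills the
    remaining numbers. *)
Lemma countable_bump_cover (R : realType) (n : nat) (Z : manifold R n)
    (H : set (Cinfty Z)) : H 0 ->
  (forall p : Z, exists2 h : Cinfty Z, H h & \forall q \near p, h q = 1) ->
  exists h : nat -> Cinfty Z, (forall k, H (h k)) /\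
    forall p : Z, exists k, \forall q \near p, h k q = 1.
Proof.
move=> H0 cov; have [B cB [oB bB]] := manifold_second_countable Z.
have [f inj_f] := countable_injP _ cB.
have /choice[h hP] : forall k, exists h : Cinfty Z, H h /\
    forall O, B O -> f O = k -> (exists2 g, H g & forall q, O q -> g q = 1) ->
      forall q, O q -> h q = 1.
  move=> k; have [[O [BO fO [g Hg gO]]]|no] := pselect (exists O, [/\ B O, f O = k
      & exists2 g, H g & forall q, O q -> g q = 1]).
    exists g; split=> // O' BO' fO' _.
    by rewrite (inj_f O' O) ?inE// fO fO'.
  by exists 0; split=> // O BO fO gO; case: no; exists O.
exists h; split=> [k|p]; first exact: (hP k).1.
have [g Hg gp] := cov p; have [O [BO Op] Og] := bB p _ gp.
have nO : nbhs p O by apply: open_nbhs_nbhs; split=> //; exact: oB.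
exists (f O); apply: filterS nO => q.
by apply: (hP (f O)).2 => //; exists g.
Qed.

(** The points are found one by one. Expanding the next minor along its last column gives a
    combination of the [x i] in which the coefficient of the newest row is, up to sign, the previous
    minor; by independence it is nonzero at some point. *)
Lemma independent_minor (K : fieldType) (T : Type) (t0 : T) (d : nat)
    (x : 'I_d -> T -> K) :
  (forall a : 'I_d -> K, (forall t, \sum_(i < d) a i * x i t = 0) ->
     forall i, a i = 0) ->
  exists F : 'I_d -> T, \det (\matrix_(i, j) x i (F j)) != 0.
Proof.
move=> free_x.
suff /(_ d (leqnn d))[F detF] : forall m (md : (m <= d)%N), exists F : nat -> T,
    \det (\matrix_(i < m, j < m) x (widen_ord md i) (F j)) != 0.
  exists (F \o val); move: detF; congr (\det _ != 0); apply/matrixP => i j.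
  by rewrite !mxE; congr (x _ _); exact: val_inj.
elim=> [|m IH] md; first by exists (fun=> t0); rewrite det_mx00 oner_eq0.
have [F detF] := IH (ltnW md).
pose C (i : 'I_m.+1) (t : T) :=
  cofactor (\matrix_(i < m.+1, j < m.+1) x (widen_ord md i)
    (if (j < m)%N then F j else t)) i ord_max.
have CE i t : C i t = C i t0.
  rewrite /C /cofactor; congr (_ * \det _); apply/matrixP => k j.
  by rewrite !mxE lift_max ltn_ord.
(* The cofactors of the last column, continued by zero to the indices above [m], so that the
   independence of the whole family applies. *)
pose a (i : 'I_d) := if insub (val i) is Some j then C j t0 else 0.
have [t at0] : exists t, \sum_(i < d) a i * x i t != 0.
  apply: contrapT => no; have {no} : forall i, a i = 0.
    by apply: free_x => t; apply: contrapT => /eqP ?; apply: no; exists t.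
  move=> /(_ (Ordinal md)); rewrite /a /= insubT => /= [|ltm].
    exact: ltnSn.
  rewrite /C /cofactor => /eqP; rewrite mulf_eq0 signr_eq0 /=; apply/negP.
  move: detF; congr (\det _ != 0); apply/matrixP => i j.
  have -> : Sub m ltm = ord_max :> 'I_m.+1 by exact: val_inj.
  rewrite !mxE lift_max ltn_ord; congr (x _ _); apply: val_inj.
  exact/esym/lift_max.
exists (fun j => if (j < m)%N then F j else t).
rewrite (expand_det_col _ ord_max); move: at0.
have aE (i : 'I_d) : ~~ (i < m.+1)%N -> a i * x i t = 0.
  by move=> im; rewrite /a insubN// mul0r.
rewrite (bigID (fun i : 'I_d => (i < m.+1)%N)) /= [X in _ + X]big1 ?addr0//.
rewrite (big_ord_narrow md) /=; congr (_ != 0); apply: eq_bigr => i _.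
rewrite !mxE ltnn mulrC; congr (_ * _); rewrite /a /= insubT//= => im.
by rewrite -(CE _ t); congr (C _ t); exact: val_inj.
Qed.

(** * Vector fields *)

Lemma cfD (R : realType) (n : nat) (Z : manifold R n) (f g : Cinfty Z) (p : Z) :
  (f + g) p = f p + g p.
Proof. by []. Qed.

Lemma cfM (R : realType) (n : nat) (Z : manifold R n) (f g : Cinfty Z) (p : Z) :
  (f * g) p = f p * g p.
Proof. by []. Qed.

Lemma cf_ext (R : realType) (n : nat) (Z : manifold R n) (f g : Cinfty Z) :
  (forall p, f p = g p) -> f = g.
Proof. by move=> fg; apply/val_inj/funext. Qed.

Lemma lvf_sum (R : realType) (n : nat) (Z : manifold R n) (F : foliation Z)
    (I : Type) (r : seq I) (X : I -> leafwise_vfield F) (p : Z) (f : Cinfty Z) :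
  (\sum_(i <- r) X i) p f = \sum_(i <- r) X i p f.
Proof.
elim: r => [|i r IH]; first by rewrite !big_nil.
by rewrite !big_cons -IH.
Qed.

Lemma lvf_ext (R : realType) (n : nat) (Z : manifold R n) (F : foliation Z)
  (X Y : leafwise_vfield F) : (forall p f, X p f = Y p f) -> X = Y.
Proof. by move=> XY; apply/val_inj/vfield_ext. Qed.

(** Where nothing is known of [g], the factor [b] vanishes; this turns local data into global data
    throughout. *)
Lemma supported_smoothM (R : realType) (n : nat) (Z : manifold R n) (U V : set Z)
    (b g : Z -> R) : open U -> open V -> supported_in U b -> smooth_on V b ->
  smooth_on (V `&` U) g -> smooth_on V (fun q => b q * g q).
Proof.
move=> oU oV [K [cK KU bK]] sb sg; have oVU : open (V `&` U) by exact: openI.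
apply: (smooth_on_extend0 oVU oV cK).
- by move=> q [Vq /KU].
- by move=> q /bK ->; rewrite mul0r.
- by apply: smooth_onM => //; exact: smooth_onS sb.
Qed.

Lemma extend_vfield (R : realType) (n : nat) (Z : manifold R n) (U : set Z)
    (b : Cinfty Z) (X : Z -> Cinfty Z -> R) : open U -> supported_in U b ->
  vector_field_on U X -> exists Y : vfield Z, forall q f, Y q f = b q * X q f.
Proof.
move=> oU sb [tX sX]; suff vY : vector_field_on setT (fun q f => b q * X q f).
  by exists (VField vY).
split=> [q _|f]; last first.
  apply: (supported_smoothM oU openT sb); first exact: Cinfty_smooth.
  by rewrite setTI.
have [K [_ KU bK]] := sb.
have [/KU Uq|/bK ->] := pselect (K q); last by split=> *; rewrite !mul0r ?mulr0 ?addr0.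
have [X1 X2 X3] := tX q Uq; split=> *; rewrite ?X1 ?X2 ?X3 ?mulrDr //.
  by rewrite mulrCA.
by congr +%R; rewrite mulrCA.
Qed.

Lemma ftan0 (R : realType) (n : nat) (Z : manifold R n) (F : foliation Z) (p : Z) :
  ftan F p (fun=> 0).
Proof.
have [U [X [_ Up _ _ H]]] := ftan_frame F p; apply/(H p Up); exists (fun=> 0) => f.
by rewrite big1 // => i _; rewrite mul0r.
Qed.

Lemma smooth_on_adjugate (R : realType) (n d : nat) (Z : manifold R n) (U : set Z)
    (M : Z -> 'M[R]_d) (i j : 'I_d) : open U ->
  (forall i j, smooth_on U (fun p => M p i j)) ->
  smooth_on U (fun p => (\adj (M p)) i j).
Proof.
move=> oU sM; apply: (@smooth_on_eq _ _ _ _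
  (fun p => (-1) ^+ (j + i) * \det (row' j (col' i (M p))))) => //.
  by move=> p _; rewrite mxE.
apply: smooth_onM => //; first exact: smooth_on_cst.
apply: smooth_on_det => // k l.
by apply: smooth_on_eq (sM (lift j k) (lift i l)) => // p _; rewrite !mxE.
Qed.

(** A local frame of $T\mathcal F$ is detected by finitely many functions [g j]. Any vector field is
    projected through its values on them, which for leafwise fields recovers the frame coefficients;
    a cut-off makes this global. *)
Lemma local_leafwise_projection (R : realType) (n : nat) (Z : manifold R n)
    (F : foliation Z) (p : Z) :
  exists (b : Cinfty Z) (P : vfield Z -> leafwise_vfield F),
    [/\ \forall q \near p, b q = 1,
        forall f X Y, P (f *: X + Y) = f *: P X + P Y
      & forall X : leafwise_vfield F, P X = b *: X].
Proof.
have [U [X [oU Up vX freeX spanX]]] := ftan_frame F p.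
have [g detg] := @independent_minor _ _ (0 : Cinfty Z) _ (fun i => X i p) (freeX p Up).
pose M q := \matrix_(i, j) X i q (g j).
have sM i j : smooth_on U (fun q => M q i j).
  by apply: smooth_on_eq ((vX i).2 (g j)) => // q _; rewrite mxE.
have sdet : smooth_on U (fun q => \det (M q)) by exact: smooth_on_det.
(* The matrix of the frame fields applied to the [g j] is invertible at [p] by the choice of [g],
   hence on an open neighbourhood. *)
pose V := U `&` [set q | \det (M q) != 0].
have oV : open V.
  rewrite openE => q [Uq dq]; apply: filterI; first exact: open_nbhs_nbhs.
  have cd := smooth_on_continuous oU Uq sdet.
  have nd : nbhs (\det (M q)) [set t | t != 0].
    by apply: open_nbhs_nbhs; split => //; exact: open_neq.
  exact: (cd _ nd).
have Vp : V p by [].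
have VU : V `<=` U by move=> q [].
have [c [cp sc]] := smooth_bump oV Vp.
have [K [cK KV cK0]] := sc.
have sW j i : smooth_on V (fun q => (\det (M q))^-1 * (\adj (M q)) j i).
  apply: smooth_onM => //.
    by apply: smooth_onV => //; [move=> q []|exact: smooth_onS sdet].
  by apply: smooth_on_adjugate => // k l; exact: smooth_onS (sM k l).
have /choice[Y YE] : forall i, exists Y : leafwise_vfield F,
    forall q f, Y q f = c q * X i q f.
  move=> i; have vXi : vector_field_on V (X i).
    split=> [q [Uq _]|f]; first exact: (vX i).1.
    by apply: smooth_onS ((vX i).2 f).
  have [Y YE] := extend_vfield oV sc vXi.
  suff tY : Y \in leafwise_pred F by exists (LeafwiseVField tY).
  apply/asboolP => q; have [/KV[Uq _]|nK] := pselect (K q).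
    apply/(spanX q Uq); exists (fun k => if k == i then c q else 0) => f.
    rewrite YE (bigD1 i)//= eqxx big1 ?addr0// => k /negbTE ->.
    by rewrite mul0r.
  rewrite (_ : Y q = fun=> 0); first exact: ftan0.
  by apply/funext => f; rewrite YE cK0// mul0r.
(* c times the dual frame of the X_i, extended by zero: the coefficient of X_i is
   read off the values A(g_j) through the inverse of the matrix X_i(g_j). *)
pose th (A : vfield Z) i q :=
  c q * \sum_j A q (g j) * ((\det (M q))^-1 * (\adj (M q)) j i).
have sth A i : th A i \in smooth_pred.
  apply/asboolP; apply: (supported_smoothM oV openT sc); first exact: Cinfty_smooth.
  rewrite setTI; apply: smooth_on_sum => // j; apply: smooth_onM => //.
  exact: (Cinfty_smooth V (vf_app A (g j))).
pose T A i := SmoothFun (sth A i).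
(* One factor [c] comes from the coefficient [th], the other from the extended frame field [Y i]. *)
exists (c * c), (fun A => \sum_i T A i *: Y i); split.
- by apply: filterS cp => q cq; rewrite cfM cq mulr1.
- move=> f A B /=; rewrite scaler_sumr -big_split /=; apply: eq_bigr => i _.
  rewrite scalerA -scalerDl; congr (_ *: _); apply: cf_ext => q.
  rewrite cfD cfM /= /th mulrCA -mulrDr [f q * _]mulr_sumr -big_split /=; congr (_ * _).
  by apply: eq_bigr => j _; rewrite mulrA -mulrDl.
move=> A; apply: lvf_ext => q f.
have -> : (\sum_i T A i *: Y i) q f = \sum_i th A i q * (c q * X i q f).
  rewrite lvf_sum; apply: eq_bigr => i _.
  by rewrite -YE.
have -> : (c * c *: A) q f = c q * c q * A q f by [].
have [/KV[Uq dq]|nK] := pselect (K q); last first.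
  by rewrite big1 ?cK0 ?mul0r// => i _; rewrite mul0r mulr0.
have /asboolP/(_ q) tA := lvf_tangent A; have [a aE] := (spanX q Uq _).1 tA.
rewrite aE mulr_sumr; apply: eq_bigr => i _; rewrite /th.
(* For leafwise [A] with frame coefficients [a], the row of values [A q (g j)] is [a] times [M q],
   so the inverse matrix returns [a]. *)
suff -> : \sum_j A q (g j) * ((\det (M q))^-1 * (\adj (M q)) j i) = a i by ring.
have -> : a i = ((\row_k a k) *m (M q *m ((\det (M q))^-1 *: \adj (M q)))) 0 i.
  by rewrite -scalemxAr mul_mx_adj scale_scalar_mx mulVf// mulmx1 mxE.
rewrite mulmxA mxE; apply: eq_bigr => j _; rewrite !mxE aE; congr (_ * _).
by apply: eq_bigr => k _; rewrite !mxE.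
Qed.

(** * Weighted connections *)

(** Weights add under sums and get multiplied by [f] under [fscale f]; a genuine connection has
    weight 1. This is what makes such operators easy to glue. *)
Definition weighted_connection (R : realType) (n : nat) (Z : manifold R n)
    (C : line_bundle Z) (h : Cinfty Z) (D : vfield Z -> gsection C -> gsection C) :
    Prop :=
  [/\ forall f X Y s, D (f *: X + Y) s = fscale f (D X s) + D Y s,
      forall X (a : R[i]) s t, D X (a *: s + t) = a *: D X s + D X t
    & forall X f s, D X (fscale f s) = fscale (h * vf_app X f) s + fscale f (D X s)].

Lemma csmooth_vf (R : realType) (n : nat) (Z : manifold R n) (X : vfield Z)
    (f g : Cinfty Z) : csmooth_on setT (fun q => (X q f +i* X q g)%C).
Proof. by split; [exact: (vfP X).2 f|exact: (vfP X).2 g]. Qed.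

(** The flat connection of a local frame, cut off before differentiating, to have a global function
    to differentiate, and once more after, to obtain a global section; hence the weight [c * c]. *)
Lemma local_weighted_connection (R : realType) (n : nat) (Z : manifold R n)
    (C : line_bundle Z) (p : Z) :
  exists (a : Cinfty Z) (D : vfield Z -> gsection C -> gsection C),
    (\forall q \near p, a q = 1) /\ weighted_connection a D.
Proof.
have [t at_ tp] := triv_cover C p; have oU := @tdom_open _ _ _ _ t.
have [c [cp sc]] := smooth_bump oU tp; have [K [_ KU c0]] := sc.
(* Off the trivialization nothing is asked of the frame vector, since [c] vanishes there. *)
have exe q : exists e : C q, tdom t q -> tmap t q e = 1.
  have [tq|ntq] := pselect (tdom t q); last by exists 0.
  by have [u _ tu] := tmap_bij tq; exists (u 1).
pose e q := sval (cid (exe q)).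
have te q : tdom t q -> tmap t q (e q) = 1 by exact: svalP (cid (exe q)).
have sE : smooth_section (fun q => ((c q)%:C)%C *: e q).
  move=> u au; have oV := @tdom_open _ _ _ _ u.
  have [g [g1 g2] tug] := triv_compat at_ au.
  have oUV : open (tdom t `&` tdom u) by exact: openI.
  have se (k : R[i] -> R) : smooth_on (tdom t `&` tdom u) (fun q => k (g q)) ->
      smooth_on (tdom u) (fun q => c q * k (tmap u q (e q))).
    move=> sk; apply: (supported_smoothM oU oV sc); first exact: Cinfty_smooth.
    rewrite setIC; apply: smooth_on_eq sk => // q [tq uq].
    by rewrite tug// te// mulr1.
  split; [have := se (@complex.Re R) g1|have := se (@complex.Im R) g2];
    congr smooth_on; apply/funext => q; rewrite linearZ /=;
    by case: (tmap u q (e q)) => x y /=; rewrite mul0r ?subr0 ?addr0.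
(* E is c times a local frame e, and a section s is sent to d(c s/e) E. *)
pose E := GSection sE.
have EE (s : gsection C) q : ((c q)%:C)%C *: (tmap t q (s q) : R[i]) *: E q
    = ((c q * c q)%:C)%C *: s q.
  have [tq|ntq] := pselect (tdom t q); last first.
    have -> : c q = 0 by apply: c0 => /KU.
    by rewrite mulr0 !scale0r.
  apply: (bij_inj (tmap_bij tq)); rewrite !linearZ /= te// [_ *: 1]mulr1 rmorphM /=.
  exact: mulrAC.
have sF (k : R[i] -> R) (s : gsection C) :
    smooth_on (tdom t) (fun q => k (tmap t q (s q))) ->
    (fun q => c q * k (tmap t q (s q))) \in @smooth_pred R n Z.
  move=> sk; apply/asboolP.
  apply: (supported_smoothM oU openT sc); first exact: Cinfty_smooth.
  by rewrite setTI.
pose re s : Cinfty Z := SmoothFun (sF (@complex.Re R) s (gs_smooth s at_).1).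
pose im s : Cinfty Z := SmoothFun (sF (@complex.Im R) s (gs_smooth s at_).2).
(* Vector fields act on real functions, so the complex coefficient is differentiated through its
   real and imaginary parts. *)
pose D X s := GSection (gsM_subproof E (csmooth_vf X (re s) (im s))).
have reL a s u : re (a *: s + u) =
    cf_cst (complex.Re a) * re s + (cf_cst (- complex.Im a) * im s + re u).
  apply: cf_ext => q; rewrite !(cfD, cfM) /=.
  rewrite linearP /=; case: a (tmap t q (s q)) (tmap t q (u q)) => [a1 a2] [x1 x2] [y1 y2].
  by rewrite /=; ring.
have imL a s u : im (a *: s + u) =
    cf_cst (complex.Re a) * im s + (cf_cst (complex.Im a) * re s + im u).
  apply: cf_ext => q; rewrite !(cfD, cfM) /=.
  rewrite linearP /=; case: a (tmap t q (s q)) (tmap t q (u q)) => [a1 a2] [x1 x2] [y1 y2].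
  by rewrite /=; ring.
have reM f s : re (fscale f s) = f * re s.
  apply: cf_ext => q; rewrite !cfM /= linearZ /=.
  by case: (tmap t q (s q)) => x y /=; ring.
have imM f s : im (fscale f s) = f * im s.
  apply: cf_ext => q; rewrite !cfM /= linearZ /=.
  by case: (tmap t q (s q)) => x y /=; ring.
exists (c * c), D; split; first by apply: filterS cp => q cq; rewrite cfM cq mulr1.
split.
- move=> f X Y s; apply: gsection_ext => q /=.
  rewrite !scalerA -scalerDl; congr (_ *: _); apply/eqP.
  by rewrite eq_complex /=; apply/andP; split; apply/eqP; ring.
- move=> X a s u; apply: gsection_ext => q /=.
  rewrite reL imL; have [XD XZ _] := (vfP X).1 q I.
  rewrite !XD !XZ !scalerA -scalerDl; congr (_ *: _); apply/eqP.
  by case: a => a1 a2; rewrite eq_complex /=; apply/andP; split; apply/eqP; ring.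
- move=> X f s; apply: gsection_ext => q /=.
  rewrite reM imM; have [_ _ XM] := (vfP X).1 q I.
  have L : ((c * c * vf_app X f) q)%:C%C *: s q =
      (X q f)%:C%C *: ((c q * c q)%:C%C *: s q).
    by rewrite scalerA -rmorphM /= [X q f * _]mulrC.
  rewrite !XM [X in _ = X + _]L -EE !scalerA -scalerDl; congr (_ *: _); apply/eqP.
  rewrite /re /im /=; case: (tmap t q (s q)) => x y.
  by rewrite eq_complex /=; apply/andP; split; apply/eqP; ring.
Qed.

(** Additivity at zero with [f = 1] gives [D 0 = D 0 + D 0], hence [D 0 = 0]; then [Y = 0] isolates
    the scalar part. *)
Lemma semilinear_scale (R : realType) (n : nat) (Z : manifold R n)
    (C : line_bundle Z) (M : lmodType (Cinfty Z)) (D : M -> gsection C) :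
  (forall f X Y, D (f *: X + Y) = fscale f (D X) + D Y) ->
  forall f X, D (f *: X) = fscale f (D X).
Proof.
move=> DL f X; have D0 : D 0 = 0.
  have := DL 1 0 0; rewrite scaler0 addr0; set u := D 0 => uE.
  have {}uE : u = u + u.
    rewrite [LHS]uE; congr (_ + _); apply: gsection_ext => q /=.
    by rewrite scale1r.
  by apply: (addrI u); rewrite -uE addr0.
by rewrite -[f *: X]addr0 DL D0 addr0.
Qed.

(** Used fibrewise for all three axioms of the operator built in [local_extension]. *)
Lemma scale_combination (K : comNzRingType) (V : lmodType K) (a b f : K)
    (x1 x2 y1 y2 z1 z2 : V) :
  b *: (f *: x1 + x2) + a *: (f *: y1 + y2) - (f *: z1 + z2) =
  f *: (b *: x1 + a *: y1 - z1) + (b *: x2 + a *: y2 - z2).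
Proof.
rewrite !scalerDr scalerN opprD !scalerA [f * b]mulrC [f * a]mulrC.
by rewrite (addrACA (_ *: x1)) [LHS]addrACA.
Qed.

Lemma gsD (R : realType) (n : nat) (Z : manifold R n) (C : line_bundle Z)
    (s t : gsection C) (q : Z) : (s + t) q = s q + t q.
Proof. by []. Qed.

Lemma gsN (R : realType) (n : nat) (Z : manifold R n) (C : line_bundle Z)
    (s : gsection C) (q : Z) : (- s) q = - s q.
Proof. exact: scaleN1r. Qed.

Lemma fscaleE (R : realType) (n : nat) (Z : manifold R n) (C : line_bundle Z)
    (f : Cinfty Z) (s : gsection C) (q : Z) : fscale f s q = ((f q)%:C)%C *: s q.
Proof. by []. Qed.

(** Subtracting [D (P X) s] removes two surpluses: in the Leibniz rule the derivative of [f] along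
    [P X], and on leafwise [X], where [P X] is [b *: X], the whole term [fscale b (D X s)]. *)
Lemma local_extension (R : realType) (n : nat) (Z : manifold R n) (F : foliation Z)
    (C : line_bundle Z) (A : leafwise_connection F C) (p : Z) :
  exists (h : Cinfty Z) (D : vfield Z -> gsection C -> gsection C),
    [/\ \forall q \near p, h q = 1, weighted_connection h D
      & forall (X : leafwise_vfield F) s, D X s = fscale h (A X s)].
Proof.
have [b [P [bp PL PX]]] := local_leafwise_projection F p.
have [a [D [ap [DL DS DM]]]] := local_weighted_connection C p.
exists (a * b), (fun X s => fscale b (D X s) + fscale a (A (P X) s) - D (P X) s).
split.
- by apply: filterS2 ap bp => q aq bq; rewrite cfM aq bq mulr1.
- split.
  + move=> f X Y s; rewrite PL DL (nabla_vfield_linear A) [D (lvf_val _) s](DL f (P X) (P Y)).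
    by apply: gsection_ext => q; rewrite !(gsD, gsN, fscaleE); exact: scale_combination.
  + move=> X k s u; rewrite !DS (nabla_section_linear A).
    by apply: gsection_ext => q; rewrite /= !scaleN1r; exact: scale_combination.
  move=> X f s; rewrite !DM (nabla_leibniz A); apply: gsection_ext => q.
  rewrite !(gsD, gsN, fscaleE) ![_ *: s q + _]addrC scale_combination; congr (_ + _).
  by rewrite !cfM !rmorphM -!scalerA addrK !scalerA; congr (_ *: _); ring.
move=> X s; have EA : A (b *: X) s = fscale b (A X s).
  exact: (semilinear_scale (D := fun Y => A Y s) (fun f Y W => nabla_vfield_linear A f Y W s)).
have ED : D (b *: X) s = fscale b (D X s).
  exact: (@semilinear_scale _ _ _ _ (vfield Z) (fun Y => D Y s) (fun f Y W => DL f Y W s) b X).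
rewrite PX EA ED; apply: gsection_ext => q.
rewrite !(gsD, gsN, fscaleE) addrAC subrr add0r.
by rewrite cfM rmorphM scalerA.
Qed.

(** * Locally finite sums and gluing *)

Lemma gs_sum (R : realType) (n : nat) (Z : manifold R n) (C : line_bundle Z)
    (I : Type) (r : seq I) (s : I -> gsection C) (p : Z) :
  (\sum_(i <- r) s i) p = \sum_(i <- r) s i p.
Proof.
elim: r => [|i r IH]; first by rewrite !big_nil.
by rewrite !big_cons -IH.
Qed.

(** Near [p] the sum agrees with the finite sum of sections up to [N p], which gives smoothness
    although [N] may jump from point to point. *)
Lemma locally_finite_section (R : realType) (n : nat) (Z : manifold R n)
    (C : line_bundle Z) (v : nat -> Cinfty Z) (N : Z -> nat) :
  (forall p : Z, \forall q \near p, forall k, (N p <= k)%N -> v k q = 0) ->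
  forall S : nat -> gsection C, exists T : gsection C,
    forall q, T q = \sum_(k < N q) ((v k q)%:C)%C *: S k q.
Proof.
move=> vN S; pose f q := \sum_(k < N q) ((v k q)%:C)%C *: S k q.
suff sf : smooth_section f by exists (GSection sf).
move=> t at_.
have loc p : tdom t p -> exists W : set Z, [/\ open W, W p, W `<=` tdom t
    & forall q, W q -> (\sum_(k < N p) fscale (v k) (S k)) q = f q].
  move=> tp; exists (tdom t `&` interior [set q | forall k, (N p <= k)%N -> v k q = 0]).
  split.
  - by apply: openI; [exact: tdom_open|exact: open_interior].
  - by split=> //; exact: vN.
  - by move=> q [].
  move=> q [_ /interior_subset vq].
  have vq' := nbhs_singleton (vN q).
  (* At [q] both [N p] and [N q] bound the nonzero terms, so the two sums are compared at the larger
     bound. *)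
  have ext m : (forall k, (m <= k)%N -> v k q = 0) -> forall m', (m <= m')%N ->
     \sum_(k < m') ((v k q)%:C)%C *: S k q = \sum_(k < m) ((v k q)%:C)%C *: S k q.
    move=> vm m' mm'; rewrite -(subnKC mm') big_split_ord /= [X in _ + X]big1 ?addr0//.
    by move=> k _; rewrite vm ?scale0r// leq_addr.
  rewrite gs_sum /f -(ext _ vq' (maxn (N p) (N q))) ?leq_maxr//.
  by rewrite (ext _ vq) ?leq_maxl.
split; apply: smooth_on_local => p /loc[W [oW Wp Wt Wf]]; exists W => //;
  have [s1 s2] := gs_smooth (\sum_(k < N p) fscale (v k) (S k)) at_.
  by apply: smooth_on_eq (smooth_onS Wt s1) => // q Wq; rewrite Wf.
by apply: smooth_on_eq (smooth_onS Wt s2) => // q Wq; rewrite Wf.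
Qed.

(** Each term is the difference of two consecutive products, because [h k = 1 - (1 - h k)]. *)
Lemma sum_telescope_prod (K : comNzRingType) (h : nat -> K) (m : nat) :
  \sum_(k < m) (\prod_(j < k) (1 - h j)) * h k = 1 - \prod_(j < m) (1 - h j).
Proof.
elim: m => [|m IH]; first by rewrite !big_ord0 subrr.
by rewrite !big_ord_recr /= IH; ring.
Qed.

Lemma cf_prod (R : realType) (n : nat) (Z : manifold R n) (I : Type) (r : seq I)
    (f : I -> Cinfty Z) (p : Z) : (\prod_(i <- r) f i) p = \prod_(i <- r) f i p.
Proof.
elim: r => [|i r IH]; first by rewrite !big_nil.
by rewrite !big_cons -IH.
Qed.

Lemma covariant_derivative_ext (R : realType) (n : nat) (Z : manifold R n)
    (C : line_bundle Z) (M : lmodType (Cinfty Z)) (rho : M -> vfield Z)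
    (A B : covariant_derivative C rho) : (forall X s, A X s = B X s) -> A = B.
Proof.
case: A B => [A A1 A2 A3] [B B1 B2 B3] /= E.
have {}E : A = B by apply/funext => X; apply/funext => s.
by case: B / E B1 B2 B3 => *; congr CovariantDerivative; exact: Prop_irrelevance.
Qed.

Theorem theorem5 (R : realType) (n : nat) (Z : manifold R n)
    (F : foliation Z) (C : line_bundle Z) (A : leafwise_connection F C) :
  exists G : linear_connection C, induced_leafwise F G = A.
Proof.
pose H (h : Cinfty Z) := exists2 D : vfield Z -> gsection C -> gsection C,
  weighted_connection h D &
  forall (X : leafwise_vfield F) s, D X s = fscale h (A X s).
have fscale0 (s : gsection C) : fscale 0 s = 0.
  by apply: gsection_ext => q /=; rewrite scale0r.
(* The zero operator has weight zero; it is the default demanded by [countable_bump_cover]. *)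
have H0 : H 0.
  exists (fun _ _ => 0) => [|X s]; last by rewrite fscale0.
  split=> *; apply: gsection_ext => q /=; rewrite ?mul0r ?scale0r ?scaler0 ?addr0 //.
have [|h [Hh h1]] := countable_bump_cover H0.
  by move=> p; have [h [D [hp hD hA]]] := local_extension A p; exists h => //; exists D.
have /choice[D /all_and2[wD DA]] : forall k, exists D, weighted_connection (h k) D /\
    forall (X : leafwise_vfield F) s, D X s = fscale (h k) (A X s).
  by move=> k; have [D ? ?] := Hh k; exists D.
pose v k : Cinfty Z := \prod_(j < k) (1 - h j).
have vE k q : v k q = \prod_(j < k) (1 - h j q) by rewrite /v cf_prod.
have v0 k m q : (m < k)%N -> h m q = 1 -> v k q = 0.
  move=> mk hm; rewrite vE (bigD1 (Ordinal mk)) //=.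
  by rewrite hm subrr mul0r.
have /choice[m hm] := h1.
(* The factor [1 - h (m q)] occurs in [v k] only from [k = m q + 1] on. *)
pose N q := (m q).+1.
have vN (p : Z) : \forall q \near p, forall k, (N p <= k)%N -> v k q = 0.
  by apply: filterS (hm p) => q hq k mk; exact: v0 hq.
(* The product left over by telescoping is [v (N q) q], which vanishes. *)
have one q : \sum_(k < N q) v k q * h k q = 1.
  under eq_bigr => k _ do rewrite vE.
  rewrite (sum_telescope_prod (fun k => h k q)) -vE (nbhs_singleton (vN q)) ?subr0//.
have /choice[G GE] := fun Xs : vfield Z * gsection C =>
  locally_finite_section vN (fun k => D k Xs.1 Xs.2).
pose nab X s := G (X, s).
have nabE X s q : nab X s q = \sum_(k < N q) ((v k q)%:C)%C *: D k X s q by exact: GE.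
(* Total weight 1, in the form that serves both the Leibniz rule and the restriction to leafwise
   fields. *)
have sum1 q (u : C q) (x : R[i]) :
    \sum_(k < N q) ((v k q)%:C)%C *: ((((h k q)%:C)%C * x) *: u) = x *: u.
  under eq_bigr => k _ do rewrite scalerA mulrA -rmorphM.
  by rewrite -scaler_suml -mulr_suml -rmorph_sum one mul1r.
have nL f X Y s : nab (f *: X + Y) s = fscale f (nab X s) + nab Y s.
  apply: gsection_ext => q; rewrite /= !nabE scaler_sumr -big_split /=.
  apply: eq_bigr => k _; have [-> _ _] := wD k.
  by rewrite /= scalerDr !scalerA [(f q)%:C%C * _]mulrC.
have nS X (a : R[i]) s t : nab X (a *: s + t) = a *: nab X s + nab X t.
  apply: gsection_ext => q; rewrite /= !nabE scaler_sumr -big_split /=.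
  apply: eq_bigr => k _; have [_ -> _] := wD k.
  by rewrite /= scalerDr !scalerA [a * _]mulrC.
have nM X f s : nab X (fscale f s) = fscale (vf_app X f) s + fscale f (nab X s).
  (* Spreading the term with the derivative of [f] over all [k] lets the identity be checked term by
     term. *)
  apply: gsection_ext => q; rewrite /= !nabE -(sum1 q (s q)) scaler_sumr -big_split /=.
  apply: eq_bigr => k _; have [_ _ ->] := wD k.
  by rewrite /= scalerDr rmorphM !scalerA [(f q)%:C%C * _]mulrC.
exists (CovariantDerivative nL nS nM); apply: covariant_derivative_ext => X s /=.
apply: gsection_ext => q; rewrite nabE -[RHS]scale1r -sum1.
by apply: eq_bigr => k _; rewrite DA /= mulr1.
Qed.
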